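(* Let $X$ be a normed space, let $\varphi: X\to(-\infty,\infty]$ and $f:X\to(-\infty,\infty]$ be extended-real-valued functions with $\varphi(0)=0$, and let $T_\varphi^f(x):=\inf\{\varphi(y-x)+f(y)\mid y\in X\}$ for $x\in X$. Let $\bar x\in S_0:=\{x\in \mathrm{dom}\,T_\varphi^f\mid T_\varphi^f(x)=f(x)\}$. Then for every $\epsilon\ge0$, $$\widehat\partial_\epsilon T_\varphi^f(\bar x)\subset\widehat\partial_\epsilon f(\bar x)\cap[-\widehat\partial_\epsilon\varphi(0)].$$
   Context: $X$ is a (real) normed space, $X^*$ its topological dual, and $\langle\cdot,\cdot\rangle$ the pairing between them. For $g:X\to[-\infty,\infty]$, $\mathrm{dom}\,g:=\{x\in X\mid |g(x)|<\infty\}$. For $\bar x\in\mathrm{dom}\,g$ and $\epsilon\ge0$, the $\epsilon$-Fréchet subdifferential is $$\widehat\partial_\epsilon g(\bar x):=\Big\{x^*\in X^*\;\Big|\;\liminf_{x\to\bar x}\frac{g(x)-g(\bar x)-\langle x^*,x-\bar x\rangle}{\|x-\bar x\|}\ge-\epsilon\Big\},$$ where the liminf is over $x\neq\bar x$. For a set $A\subset X^*$, $-A:=\{-a\mid a\in A\}$. *)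

(* Defs.v *)
From mathcomp Require Export all_boot all_order all_algebra.
From mathcomp Require Export all_classical all_reals all_analysis.
Export Order.TTheory GRing.Theory Num.Theory.
Export numFieldNormedType.Exports.

Set Implicit Arguments.
Unset Strict Implicit.
Unset Printing Implicit Defensive.

Local Open Scope classical_set_scope.
Local Open Scope ring_scope.
Local Open Scope ereal_scope.

Definition topological_dual (R : realType) (X : normedModType R) :
    set {linear X -> R^o} :=
  [set l : {linear X -> R^o} | continuous (l : X -> R^o)].

Arguments topological_dual {R} X.

Definition opp_set (R : realType) (X : normedModType R)
    (A : set {linear X -> R^o}) : set {linear X -> R^o} :=
  [set ((\- a)%R : {linear X -> R^o}) | a in A].

(* Points where [g] is finite: [-oo] is excluded as well as [+oo]. *)
Definition finite_dom (R : realType) (X : normedModType R)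
    (g : X -> \bar R) : set X :=
  [set x | `|g x| < +oo].

(* Meaningful for [x0] in [finite_dom g] and [0 <= eps]. [x0^'] is the filter
   of punctured neighborhoods of [x0]. If [X] is trivial, this filter is
   improper, the lower limit is [+oo] and the inequality holds. *)
Definition frechet_subdiff (R : realType) (X : normedModType R)
    (eps : R) (g : X -> \bar R) (x0 : X) : set {linear X -> R^o} :=
  topological_dual X `&`
  [set l : {linear X -> R^o} |
     limf_einf
       (fun x : X => (g x - g x0 - (l (x - x0)%R : R)%:E) / `|(x - x0)%R|%R%:E)
       x0^' >= - eps%:E].

Definition inf_conv (R : realType) (X : normedModType R)
    (phi f : X -> \bar R) (x : X) : \bar R :=
  ereal_inf [set phi (y - x)%R + f y | y in [set: X]].

Definition coincidence_set (R : realType) (X : normedModType R)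
    (phi f : X -> \bar R) : set X :=
  [set x | finite_dom (inf_conv phi f) x /\ inf_conv phi f x = f x].

(* Main.v *)
Require Import Defs.

Set Implicit Arguments.
Unset Strict Implicit.
Unset Printing Implicit Defensive.

Local Open Scope classical_set_scope.
Local Open Scope ring_scope.
Local Open Scope ereal_scope.

(** Choosing [y = x] in the infimum gives [T <= f], and choosing [y = xbar]
    gives [T (xbar - u) <= phi u + f xbar]; both are equalities at [x = xbar],
    resp. [u = 0], since [T xbar = f xbar] and [phi 0 = 0]. Hence the difference
    quotients of [T] at [xbar] lie below those of [f] at [xbar] and, through the
    reflection [u |-> xbar - u], below those of [phi] at [0] with [- l] in place
    of [l]; the lower limits compare accordingly. *)

Lemma linear_ext (R : realType) (X : normedModType R)
    (k l : {linear X -> R^o}) : k =1 l -> k = l.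
Proof.
case: k l => f cf [g cg] /= /funext fg.
move: cf cg; rewrite {}fg => -[[a] [b]] [[c] [d]].
by rewrite (Prop_irrelevance a c) (Prop_irrelevance b d).
Qed.

(** For [V] in [F], the preimage of [V] under [h] lies in [G], and there [q] stays above the infimum
    of [p] on [V]. *)
Lemma le_limf_einf_comp (R : realType) (T U : topologicalType)
    (F : set_system T) (G : set_system U) (h : U -> T) (p : T -> \bar R)
    (q : U -> \bar R) :
  h @ G --> F -> (forall u, p (h u) <= q u) -> limf_einf p F <= limf_einf q G.
Proof.
move=> hGF pq; rewrite !limf_einfE; apply: ge_ereal_sup => _ [V FV <-].
apply: (@le_trans _ _ (ereal_inf (q @` (h @^-1` V)))); last first.
  by apply: ereal_sup_ubound; exists (h @^-1` V) => //; exact: hGF.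
apply: le_ereal_inf_tmp => _ [u Vhu <-]; apply: le_trans (pq u).
by apply: ereal_inf_lbound; exists (h u).
Qed.

(** Injectivity keeps [h v] off the centre [h u] for [v] other than [u]. *)
Lemma cvg_dnbhs_inj (T U : topologicalType) (h : U -> T) (u : U) :
  {for u, continuous h} -> injective h -> h @ u^' --> (h u)^'.
Proof.
move=> hu hinj A /hu; rewrite /= !nbhs_simpl /=.
rewrite /dnbhs /within /=; apply: filterS => v Av vu.
by apply: Av; apply: contra_neq vu => /hinj.
Qed.

Theorem proposition2p1 (R : realType) (X : normedModType R)
    (phi f : X -> \bar R)
    (phi_gtNy : forall x : X, -oo < phi x)
    (f_gtNy : forall x : X, -oo < f x)
    (phi0 : phi 0%R = 0)
    (xbar : X) (xbar_S0 : coincidence_set phi f xbar)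
    (eps : R) (eps_ge0 : (0 <= eps)%R) :
  frechet_subdiff eps (inf_conv phi f) xbar `<=`
    frechet_subdiff eps f xbar `&` opp_set (frechet_subdiff eps phi 0%R).
Proof.
case: xbar_S0 => Tfin Tf l [lcont lT].
have fin_f : f xbar \is a fin_num by rewrite fin_num_abs -Tf.
(* The case [w = 0] matters: the quotients get compared at every point, centre included. *)
have inv_norm_ge0 (w : X) : 0 <= (`|w|%R%:E)^-1.
  by rewrite inve_ge0 lee_fin.
have T_le x y : inf_conv phi f x <= phi (y - x)%R + f y.
  by apply: ereal_inf_lbound; exists y.
split.
  split=> //; apply: le_trans lT _.
  apply: (@le_limf_einf_comp _ _ _ _ _ id) => [|x]; first exact: cvg_id.
  apply: lee_wpmul2r => //; rewrite Tf !leeB //.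
  by rewrite (le_trans (T_le x x)) // subrr phi0 add0e.
exists (\- l)%R; last by apply: linear_ext => x /=; rewrite opprK.
split; first by move=> x; apply: cvgN; exact: lcont.
apply: le_trans lT _.
apply: (@le_limf_einf_comp _ _ _ _ _ (fun u => xbar - u)%R) => [|u].
  rewrite -[X in _ --> X^']subr0; apply: cvg_dnbhs_inj.
    by apply: cvgB; [exact: cvg_cst | exact: cvg_id].
  by move=> u v /addrI/oppr_inj.
rewrite (_ : xbar - u - xbar = - u)%R; last by rewrite addrAC subrr sub0r.
rewrite normrN subr0; apply: lee_wpmul2r => //.
(* As [f xbar] is finite, it can cross the inequality, which leaves [T_le] at [y = xbar]. *)
rewrite phi0 sube0 raddfN leeB // Tf leeBlDr //.
by rewrite (le_trans (T_le _ xbar)) // subKr.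
Qed.
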